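(* Let $U,V,W$ be finite-dimensional real vector spaces with fixed bases, let $r_g$ be the complex generic rank of $U_{\mathbb{C}}\otimes V_{\mathbb{C}}\otimes W_{\mathbb{C}}$, and let $D_r=\{A\in U_+\otimes V_+\otimes W_+ : \operatorname{rank}_+(A)\le r\}$. Let $r<r_g$. Then a general $A\in D_r$ has both real rank and complex rank equal to $r$. If $U\otimes V\otimes W$ is $r$-identifiable, then a general $A\in D_r$ has a unique nonnegative rank-$r$ decomposition.
   Context: For a real vector space $U$ with a fixed basis, $U_+$ is the set of vectors with nonnegative coordinates, and $U_+\otimes V_+\otimes W_+$ is the cone of nonnegative tensors, i.e. the tensors in $U\otimes V\otimes W$ that are finite sums of $u\otimes v\otimes w$ with $u\in U_+$, $v\in V_+$, $w\in W_+$ (equivalently, all coordinates are nonnegative). $U_{\mathbb{C}}=U\otimes_{\mathbb{R}}\mathbb{C}$. The integer $r$ is positive. Ranks: the real (resp. complex) rank of a tensor is the minimum number of rank-one tensors $u\otimes v\otimes w$ with vectors in $U,V,W$ (resp. $U_{\mathbb{C}},V_{\mathbb{C}},W_{\mathbb{C}}$) summing to it. The nonnegative rank $\operatorname{rank}_+(A)$ of a nonnegative tensor $A$ is the minimum number of terms $u\otimes v\otimes w$ with $u\in U_+,v\in V_+,w\in W_+$ summing to $A$. The complex generic rank $r_g$ is the integer $s$ such that the set of tensors of complex rank $s$ in $U_{\mathbb{C}}\otimes V_{\mathbb{C}}\otimes W_{\mathbb{C}}$ contains a nonempty Zariski open subset. Decompositions: a rank-$r$ decomposition (resp. nonnegative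 rank-$r$ decomposition) of $A$ is an expression $A=\sum_{i=1}^r T_i$ with $r$ equal to the rank (resp. nonnegative rank) of $A$, where each $T_i$ is a rank-one tensor (resp. a nonzero $u_i\otimes v_i\otimes w_i$ with $u_i\in U_+,v_i\in V_+,w_i\in W_+$). It is unique if the unordered set $\{T_1,\dots,T_r\}$ is unique. General: for a semialgebraic set $S$, ''a general point of $S$ has property $\mathscr{P}$'' means that the points of $S$ not having $\mathscr{P}$ are contained in a semialgebraic subset $C\subseteq S$ with $\dim C<\dim S$. $r$-identifiable: $U\otimes V\otimes W$ is $r$-identifiable if a general tensor of real rank $r$ in $U\otimes V\otimes W$ has a unique (real) rank-$r$ decomposition. *)

(* Defs.v *)
From HB Require Import structures.
From mathcomp Require Import all_boot all_order all_algebra.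
From mathcomp Require Import ring_quotient complex reals.
From mathcomp Require Import mpoly.

Set Implicit Arguments.
Unset Strict Implicit.
Unset Printing Implicit Defensive.

Import Order.TTheory GRing.Theory Num.Theory.
Local Open Scope ring_scope.

(** Affine space [K^I] is [{ffun I -> K}].  Polynomial functions on it are
    polynomials in [#|I|] variables, the k-th one being the coordinate
    [enum_val k]. *)
Definition peval (K : comNzRingType) (I : finType) (f : {mpoly K[#|I|]})
    (x : {ffun I -> K}) : K :=
  f.@[fun k => x (enum_val k)].

Definition zariski_open (K : fieldType) (I : finType)
    (O : {ffun I -> K} -> Prop) : Prop :=
  exists F : {mpoly K[#|I|]} -> Prop,
    forall x, O x <-> exists2 f, F f & peval f x != 0.

(** A finite union of sets [{x | f x = 0 for f in c.1, g x > 0 for g in c.2}]. *)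
Definition semialgebraic (R : realType) (I : finType)
    (S : {ffun I -> R} -> Prop) : Prop :=
  exists F : seq (seq {mpoly R[#|I|]} * seq {mpoly R[#|I|]}),
    forall x, S x <->
      exists2 c, c \in F &
        (forall f, f \in c.1 -> peval f x = 0) /\
        (forall g, g \in c.2 -> 0 < peval g x).

(** The dimension of a semialgebraic set [S] is the Krull dimension of the ring
    [R[X] / I(S)], where [I(S)] is the ideal of the polynomials vanishing on [S];
    the prime ideals of this ring are the prime ideals of [R[X]] containing
    [I(S)].  [dim_ge S d] says that they admit a strict chain of length [d]
    (so it fails for every [d] when [S] is empty). *)
Definition dim_ge (R : realType) (I : finType)
    (S : {ffun I -> R} -> Prop) (d : nat) : Prop :=
  exists P : 'I_d.+1 -> {pred {mpoly R[#|I|]}},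
    (forall i, [/\ idealr_closed (P i), prime_idealr_closed (P i) &
        forall f, (forall x, S x -> peval f x = 0) -> f \in P i]) /\
    (forall i j : 'I_d.+1, (i < j)%N ->
        {subset P i <= P j} /\ exists2 f, f \in P j & f \notin P i).

Definition dim_lt (R : realType) (I : finType)
    (C S : {ffun I -> R} -> Prop) : Prop :=
  exists2 d, dim_ge S d & ~ dim_ge C d.

Definition general_point (R : realType) (I : finType)
    (S Q : {ffun I -> R} -> Prop) : Prop :=
  exists C : {ffun I -> R} -> Prop,
    [/\ semialgebraic C, forall x, C x -> S x,
        forall x, S x -> ~ Q x -> C x & dim_lt C S].

(** [K^m (x) K^n (x) K^p], in coordinates with respect to the fixed bases. *)
Definition tensor (K : fieldType) (m n p : nat) :=
  {ffun 'I_m * 'I_n * 'I_p -> K}.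

Definition outer (K : fieldType) (m n p : nat)
    (u : 'rV[K]_m) (v : 'rV[K]_n) (w : 'rV[K]_p) : tensor K m n p :=
  [ffun t => u 0 t.1.1 * v 0 t.1.2 * w 0 t.2].

Definition rank_one (K : fieldType) (m n p : nat) (T : tensor K m n p) : Prop :=
  T != 0 /\ exists u v w, T = outer u v w.

Definition nonneg_vec (R : realType) (m : nat) (u : 'rV[R]_m) : Prop :=
  forall i, 0 <= u 0 i.

Definition nonneg_product (R : realType) (m n p : nat) (T : tensor R m n p) :
    Prop :=
  exists u v w,
    [/\ nonneg_vec u, nonneg_vec v, nonneg_vec w & T = outer u v w].

Definition sum_of (K : fieldType) (m n p : nat) (Q : tensor K m n p -> Prop)
    (A : tensor K m n p) (s : seq (tensor K m n p)) : Prop :=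
  (forall T, T \in s -> Q T) /\ A = \sum_(T <- s) T.

Definition nonneg_tensor (R : realType) (m n p : nat) (A : tensor R m n p) :
    Prop :=
  exists s, sum_of (@nonneg_product R m n p) A s.

(** [r] is the minimum number of tensors satisfying [Q] that sum to [A]. *)
Definition min_terms (K : fieldType) (m n p : nat) (Q : tensor K m n p -> Prop)
    (A : tensor K m n p) (r : nat) : Prop :=
  (exists2 s, sum_of Q A s & size s = r) /\
  (forall s, sum_of Q A s -> (r <= size s)%N).

Definition has_rank (K : fieldType) (m n p : nat) (A : tensor K m n p)
    (r : nat) : Prop :=
  min_terms (@rank_one K m n p) A r.

Definition has_nonneg_rank (R : realType) (m n p : nat) (A : tensor R m n p)
    (r : nat) : Prop :=
  min_terms (@nonneg_product R m n p) A r.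

Definition complexify (R : realType) (m n p : nat) (A : tensor R m n p) :
    tensor R[i] m n p :=
  [ffun t => real_complex R (A t)].

Definition complex_generic_rank (R : realType) (m n p s : nat) : Prop :=
  exists O : tensor R[i] m n p -> Prop,
    [/\ zariski_open O, exists A, O A & forall A, O A -> has_rank A s].

Definition rank_decomposition (R : realType) (m n p r : nat)
    (A : tensor R m n p) (s : seq (tensor R m n p)) : Prop :=
  [/\ has_rank A r, size s = r & sum_of (@rank_one R m n p) A s].

Definition nonneg_rank_decomposition (R : realType) (m n p r : nat)
    (A : tensor R m n p) (s : seq (tensor R m n p)) : Prop :=
  [/\ has_nonneg_rank A r, size s = r &
      sum_of (fun T => T != 0 /\ nonneg_product T) A s].

(** Existence, and uniqueness as an unordered set [{T_1, ..., T_r}]. *)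
Definition unique_upto_order (T : eqType) (D : seq T -> Prop) : Prop :=
  exists2 s, D s & forall s', D s' -> s' =i s.

Definition identifiable (R : realType) (m n p r : nat) : Prop :=
  general_point (fun A : tensor R m n p => has_rank A r)
    (fun A => unique_upto_order (rank_decomposition r A)).

Definition nonneg_rank_le (R : realType) (m n p r : nat) (A : tensor R m n p) :
    Prop :=
  nonneg_tensor A /\ exists2 k, has_nonneg_rank A k & (k <= r)%N.

(* Main.v *)
(** Replacing each vector by the coordinatewise square of another one
    parametrizes, by one and the same polynomial map [sq_sum], the tensors of
    nonnegative rank at most [r] (over [R]) and the sums of [r] products (over
    [C]).  So [D_r] is the image of an affine space: its vanishing ideal is prime,
    it is semialgebraic by quantifier elimination, and every hypersurface not
    containing [D_r] cuts it in a set of smaller dimension.  It remains to find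
    such a hypersurface around the bad points.

    Ranks: if every polynomial vanishing on the sums of [r - 1] complex products
    vanished on the sums of [r], it would vanish on all tensors, so that the sums
    of [r - 1] products would be Zariski dense and [r_g < r].  Hence some complex
    polynomial separates the two sets; its real or imaginary part vanishes on the
    real tensors of complex rank less than [r] and not on [D_r].

    Uniqueness: an exceptional set of smaller dimension among the tensors of real
    rank [r] lies in a hypersurface not containing all of them.  That one does not
    contain [D_r] either, because a polynomial vanishing on [D_r] vanishes on all
    sums of [r] products (real points are dense in the complex affine space of
    parameters).  The product of the two equations is the required one. *)

Require Import Defs.
From mathcomp Require Import all_boot all_order all_algebra.
From mathcomp Require Import complex reals.
From mathcomp Require Import boolp ring_quotient mpoly ordered_qelim.
From mathcomp Require Import (coercions) qe_rcf.

Set Implicit Arguments.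
Unset Strict Implicit.
Unset Printing Implicit Defensive.

Import Order.TTheory GRing.Theory Num.Theory.
Local Open Scope ring_scope.

(** * Polynomial maps *)

Section PolynomialMaps.
Variables (K : fieldType) (I J : finType).
Implicit Types (f g : {mpoly K[#|I|]}) (x y : {ffun I -> K}).

Lemma pevalM f g x : peval (f * g) x = peval f x * peval g x.
Proof. exact: mevalM. Qed.

Lemma peval_line f x y :
  exists q : {poly K}, forall t, peval f [ffun i => x i + t * y i] = q.[t].
Proof.
exists (\sum_(m <- msupp f) (f@_m)%:P *
   \prod_k ((x (enum_val k))%:P + 'X * (y (enum_val k))%:P) ^+ m k) => t.
rewrite /peval mevalE horner_sum; apply: eq_bigr => m _.
rewrite hornerM hornerC horner_prod; congr (_ * _); apply: eq_bigr => k _.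
by rewrite horner_exp hornerD hornerM hornerX !hornerC ffunE.
Qed.

Definition pvar (i : I) : {mpoly K[#|I|]} := 'X_(enum_rank i).

Lemma peval_pvar i x : peval (pvar i) x = x i.
Proof. by rewrite /peval /pvar mevalXU enum_rankK. Qed.

Definition pmap (phi : J -> {mpoly K[#|I|]}) x : {ffun J -> K} :=
  [ffun j => peval (phi j) x].

Definition pcomp (h : {mpoly K[#|J|]}) (phi : J -> {mpoly K[#|I|]}) :
    {mpoly K[#|I|]} :=
  h \mPo [tuple phi (enum_val k) | k < #|J|].

Lemma peval_pcomp h phi x : peval (pcomp h phi) x = peval h (pmap phi x).
Proof.
rewrite /peval /pcomp comp_mpoly_meval; apply: meval_eq => k.
by rewrite tnth_mktuple ffunE.
Qed.

End PolynomialMaps.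

(** In characteristic zero the naturals give more distinct roots than the degree allows. They are
    also real when [K] is complex. *)
Lemma poly_eq0_on_nat (K : numFieldType) (q : {poly K}) :
  (forall n : nat, q.[n%:R] = 0) -> q = 0.
Proof.
move=> q0; apply/eqP/negPn/negP => nz_q.
pose s := [seq n%:R : K | n <- iota 0 (size q)].
have: (size s < size q)%N.
  apply: max_poly_roots => //.
    by apply/allP => _ /mapP[n _ ->]; rewrite rootE q0.
  by rewrite map_inj_uniq ?iota_uniq // => a b /eqP; rewrite eqr_nat => /eqP.
by rewrite size_map size_iota ltnn.
Qed.

(** Irreducibility of affine space: on the line through [x] and [y] both restrictions are nonzero
    polynomials, hence so is their product. *)
Lemma common_nonzero (K : numFieldType) (I : finType) (f g : {mpoly K[#|I|]}) x y :
  peval f x != 0 -> peval g y != 0 ->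
  exists z, peval f z != 0 /\ peval g z != 0.
Proof.
move=> fx gy.
have [q qE] := peval_line f x [ffun i => y i - x i].
have [p pE] := peval_line g x [ffun i => y i - x i].
have nz_q : q != 0.
  apply: contraNneq fx => q0; have := qE 0; rewrite q0 horner0 => <-.
  by apply/eqP; congr peval; apply/ffunP => i; rewrite !ffunE mul0r addr0.
have nz_p : p != 0.
  apply: contraNneq gy => p0; have := pE 1; rewrite p0 horner0 => <-.
  by apply/eqP; congr peval; apply/ffunP => i; rewrite !ffunE mul1r addrC subrK.
have : q * p != 0 by rewrite mulf_neq0.
apply: contraPP => no_z; apply/negP/negPn/eqP/poly_eq0_on_nat => n.
apply/eqP; rewrite hornerM -qE -pE mulf_eq0; apply/norP => -[h1 h2].
by apply: no_z; eexists; split; [exact: h1 | exact: h2].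
Qed.

Definition cplx (R : realType) (I : finType) (x : {ffun I -> R}) :
    {ffun I -> R[i]} :=
  [ffun i => real_complex R (x i)].

(** Write [z = a + i b] with [a] and [b] real: the line [a + t b] is real at natural [t] and reaches
    [z] at [t = i]. *)
Lemma nonzero_at_real (R : realType) (I : finType) (f : {mpoly R[i][#|I|]}) z :
  peval f z != 0 -> exists x : {ffun I -> R}, peval f (cplx x) != 0.
Proof.
apply: contraPP => no_x; apply/negP/negPn.
have f0 x : peval f (cplx x) = 0.
  by apply/eqP/negPn/negP => fx; apply: no_x; exists x.
pose a := [ffun i => complex.Re (z i)]; pose b := [ffun i => complex.Im (z i)].
have [q qE] := peval_line f (cplx a) (cplx b).
suff q0 : q = 0.
  have := qE 'i%C; rewrite q0 horner0 => <-; apply/eqP; congr peval.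
  by apply/ffunP => i; rewrite !ffunE [LHS]complexE.
apply: poly_eq0_on_nat => n; rewrite -qE -[RHS](f0 [ffun i => a i + n%:R * b i]).
congr peval; apply/ffunP => i.
by rewrite !ffunE rmorphD rmorphM /= rmorph_nat.
Qed.

(** * Chains of primes in polynomial rings *)

Section IndependenceModuloIdeal.
Variables (R : fieldType) (n : nat).
Implicit Types (P Q : {pred {mpoly R[n]}}) (f : {mpoly R[n]}).

(** Linear independence over [R] in the quotient by [P], stated without forming the quotient. *)
Definition indep_mod P (T : finType) (F : T -> {mpoly R[n]}) :=
  forall c : T -> R, \sum_t c t *: F t \in P -> forall t, c t = 0.

Lemma ideal_mulr P f g : idealr_closed P -> f \in P -> f * g \in P.
Proof. by case=> P0 _ PD fP; rewrite mulrC -[_ * _]addr0 PD. Qed.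

Lemma ideal_addIl P f g : idealr_closed P -> f \in P -> g + f \in P -> g \in P.
Proof. by case=> P0 _ PD fP /(PD (-1) _ _ fP); rewrite mulN1r addrCA addNr addr0. Qed.

Lemma indep_mod1 P : idealr_closed P -> indep_mod P (fun _ : 'I_1 => 1).
Proof.
move=> idP c; rewrite big_ord1 => cP t; rewrite (ord1 t).
apply/eqP/negPn/negP => nz_c; case: (idP) => _ /negP[].
have -> : 1 = (c ord0 *: 1) * ((c ord0)^-1)%:MP_[n].
  by rewrite -mul_mpolyC mulr1 -rmorphM /= mulfV.
exact: ideal_mulr.
Qed.

(** Modulo [Q] only the constant term survives, so [G 0 = 0]; then one factor [f] cancels modulo the
    prime [P], and induction applies. *)
Lemma powers_coef_eq0 P Q f (G : nat -> {mpoly R[n]}) k :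
    idealr_closed P -> prime_idealr_closed P -> idealr_closed Q ->
    {subset P <= Q} -> f \in Q -> f \notin P ->
    (forall j, G j \in Q -> G j = 0) ->
  \sum_(j < k) G j * f ^+ j \in P -> forall j, (j < k)%N -> G j = 0.
Proof.
move=> idP prP idQ sPQ fQ fP; elim: k G => [|k IHk] G GQ // sumP.
have sumE : \sum_(j < k.+1) G j * f ^+ j =
    G 0 + f * \sum_(j < k) G j.+1 * f ^+ j.
  rewrite big_ord_recl expr0 mulr1 mulr_sumr; congr (_ + _).
  by apply: eq_bigr => j _; rewrite exprS mulrCA.
have G0 : G 0 = 0.
  apply: GQ; move: (sPQ _ sumP); rewrite sumE.
  exact: ideal_addIl idQ (ideal_mulr _ idQ fQ).
have: \sum_(j < k) G j.+1 * f ^+ j \in P.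
  by move: sumP; rewrite sumE G0 add0r => /prP; rewrite (negPf fP).
move=> /(IHk (fun j => G j.+1) (fun j => GQ _)) tl [|j] //; exact: tl.
Qed.

(** Grouped by powers of [f], a combination has as coefficients combinations of the [F t], which are
    zero as soon as they lie in [Q]. *)
Lemma indep_mod_step P Q f k (T : finType) (F : T -> {mpoly R[n]}) :
    idealr_closed P -> prime_idealr_closed P -> idealr_closed Q ->
    {subset P <= Q} -> f \in Q -> f \notin P ->
  indep_mod Q F -> indep_mod P (fun tj : T * 'I_k => F tj.1 * f ^+ tj.2).
Proof.
move=> idP prP idQ sPQ fQ fP indF c sumP.
pose G j := if insub j is Some i then \sum_t c (t, i) *: F t else 0.
have GE (i : 'I_k) : G i = \sum_t c (t, i) *: F t by rewrite /G valK.
have GQ j : G j \in Q -> G j = 0.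
  rewrite /G; case: insubP => // i _ _ /indF c0.
  by rewrite big1 // => t _; rewrite c0 scale0r.
have sumE : \sum_tj c tj *: (F tj.1 * f ^+ tj.2) = \sum_(j < k) G j * f ^+ j.
  rewrite (eq_bigr (fun p => c (p.1, p.2) *: (F p.1 * f ^+ p.2))); last by case.
  rewrite -(pair_bigA _ (fun t j => c (t, j) *: (F t * f ^+ j))) exchange_big /=.
  apply: eq_bigr => j _; rewrite GE mulr_suml; apply: eq_bigr => t _.
  by rewrite scalerAl.
move: sumP; rewrite sumE => /(powers_coef_eq0 idP prP idQ sPQ fQ fP GQ) G0 [t j].
apply: (indF (fun t => c (t, j))); rewrite -GE G0 //.
by case: idQ.
Qed.

Lemma card_indep_mod P (T : finType) (F : T -> {mpoly R[n]}) D :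
    0 \in P -> indep_mod P F -> (forall t, (msize (F t) <= D)%N) ->
  (#|T| <= D ^ n)%N.
Proof.
move=> P0 indF szF; rewrite leqNgt; apply/negP => lt_T.
(* A monomial of degree below [D] has all its exponents below [D], so this box of [D ^ n] monomials
   suffices. With more rows than columns, the coefficient matrix has a nonzero kernel vector, which
   is a linear relation. *)
pose e (m : {ffun 'I_n -> 'I_D}) := [multinom (m i : nat) | i < n].
pose A := \matrix_(t < #|T|, m < #|{ffun 'I_n -> 'I_D}|)
   (F (enum_val t))@_(e (enum_val m)).
have : kermx A != 0.
  rewrite kermx_eq0 /row_free; apply: contraTneq lt_T => <-.
  by rewrite -leqNgt (leq_trans (rank_leq_col _)) // card_ffun !card_ord.
case/rowV0Pn => v /sub_kermxP vA; apply/negP/negPn/eqP.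
have sum0 : \sum_t v 0 (enum_rank t) *: F t = 0.
  apply/mpolyP => m; rewrite mcoeff0 raddf_sum /=.
  have [lt_m|le_m] := ltnP (mdeg m) D; last first.
    rewrite big1 // => t _; rewrite mcoeffZ memN_msupp_eq0 ?mulr0 //.
    exact/msize_mdeg_ge/(leq_trans (szF t)).
  have ltm i : (m i < D)%N.
    by apply: leq_ltn_trans lt_m; rewrite mdegE (bigD1 i) //= leq_addr.
  have -> : m = e [ffun i => Ordinal (ltm i)].
    by apply/mnmP => i; rewrite mnmE ffunE.
  move/matrixP/(_ 0 (enum_rank [ffun i => Ordinal (ltm i)])): vA.
  rewrite !mxE => vA0; rewrite -[RHS]vA0 [RHS](reindex enum_rank) /=; last first.
    exact/onW_bij/enum_rank_bij.
  by apply: eq_bigr => t _; rewrite mcoeffZ mxE !enum_rankK.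
apply/rowP => t; rewrite mxE -[t]enum_valK; apply: (indF (fun t => v 0 (enum_rank t))).
by rewrite sum0.
Qed.

Lemma msize_mul_exp_le (g f : {mpoly R[n]}) j :
  (msize (g * f ^+ j) <= msize g + j * (msize f).+1)%N.
Proof.
elim: j => [|j IHj]; first by rewrite expr0 mulr1 addn0.
rewrite exprSr mulrA (leq_trans (msizeM_le _ _)) // -addnS mulSn addnCA addnC.
by rewrite leq_add2l.
Qed.

(* The families are the products of powers, with exponents less than [k], of
   elements [f_i] of [P (i + 1)] outside [P i]. *)
Lemma indep_mod_chain d (P : 'I_d.+1 -> {pred {mpoly R[n]}}) :
    (forall i, idealr_closed (P i)) -> (forall i, prime_idealr_closed (P i)) ->
    (forall i j : 'I_d.+1, (i < j)%N ->
       {subset P i <= P j} /\ exists2 f, f \in P j & f \notin P i) ->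
  exists D, forall k, exists (T : finType) (F : T -> {mpoly R[n]}),
    [/\ #|T| = (k ^ d)%N, forall t, (msize (F t) <= (D * k).+1)%N &
        indep_mod (P ord0) F].
Proof.
elim: d P => [|d IHd] P idP prP chP.
  exists 0 => k; exists 'I_1, (fun _ => 1); rewrite card_ord expn0; split=> //.
    by move=> _; rewrite msize1.
  exact: indep_mod1.
have [D DP] := IHd (fun i => P (lift ord0 i)) (fun i => idP _) (fun i => prP _)
  (fun i j ij => chP (lift ord0 i) (lift ord0 j) ij).
have [sP [f fQ fP]] := chP ord0 (lift ord0 ord0) isT.
exists (D + (msize f).+1)%N => k; have [T [F [cardT szF indF]]] := DP k.
exists (T * 'I_k)%type, (fun tj : T * 'I_k => F tj.1 * f ^+ tj.2); split.
- by rewrite card_prod card_ord cardT expnSr.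
- case=> t j; rewrite (leq_trans (msize_mul_exp_le _ _ _)) // mulnDl -addSn.
  by rewrite leq_add // mulnC leq_mul2l ltnW ?orbT.
- exact: indep_mod_step indF.
Qed.

(* [k ^ d] independent polynomials of degree at most [D k] in a space of
   dimension at most [(D k + 1) ^ n], for all [k]. *)
Lemma prime_chain_leq d (P : 'I_d.+1 -> {pred {mpoly R[n]}}) :
    (forall i, idealr_closed (P i)) -> (forall i, prime_idealr_closed (P i)) ->
    (forall i j : 'I_d.+1, (i < j)%N ->
       {subset P i <= P j} /\ exists2 f, f \in P j & f \notin P i) ->
  (d <= n)%N.
Proof.
move=> idP prP chP; have [D DP] := indep_mod_chain idP prP chP.
(* Since [k] exceeds [D.+1 ^ n], one gets [(D.+1 * k) ^ n < k ^ n.+1 <= k ^ d]. *)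
rewrite leqNgt; apply/negP => lt_nd; pose k := (D.+1 ^ n).+1.
have [T [F [cardT szF indF]]] := DP k.
have P0 : 0 \in P ord0 by case: (idP ord0).
have := card_indep_mod P0 indF szF; rewrite cardT leqNgt => /negP[].
apply: leq_trans (_ : (k ^ n.+1 <= _)%N); last exact: leq_pexp2l.
apply: leq_ltn_trans (_ : ((D.+1 * k) ^ n < _)%N).
  by case: (n) => [|n'] //; rewrite leq_exp2r // mulSn -addn1 addnC leq_add2r.
by rewrite expnMn expnS ltn_pmul2r ?expn_gt0.
Qed.

End IndependenceModuloIdeal.

(** * Dimension *)

Section Dimension.
Variables (R : realType) (I : finType).
Implicit Types (S C : {ffun I -> R} -> Prop) (f g h : {mpoly R[#|I|]}).

Definition vanishing S : {pred {mpoly R[#|I|]}} :=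
  fun f => `[< forall x, S x -> peval f x = 0 >].

Lemma vanishingP S f : reflect (forall x, S x -> peval f x = 0) (f \in vanishing S).
Proof. exact: asboolP. Qed.

Lemma vanishingPn S f :
  reflect (exists2 x, S x & peval f x != 0) (f \notin vanishing S).
Proof.
apply: (iffP idP) => [/vanishingP|[x Sx /eqP fx]].
  by move=> /existsNP[x /not_implyP[Sx /eqP fx]]; exists x.
by apply/vanishingP => /(_ x Sx).
Qed.

Lemma idealr_vanishing S x : S x -> idealr_closed (vanishing S).
Proof.
move=> Sx; split.
- by apply/vanishingP => y _; rewrite /peval meval0.
- by apply/vanishingPn; exists x => //; rewrite /peval meval1 oner_neq0.
move=> a f g /vanishingP f0 /vanishingP g0; apply/vanishingP => y Sy.
by rewrite /peval mevalD mevalM [f.@[_]]f0 // [g.@[_]]g0 // mulr0 addr0.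
Qed.

Lemma dim_ge_leq S d : dim_ge S d -> (d <= #|I|)%N.
Proof.
case=> P [idP chP].
by apply: (prime_chain_leq _ _ chP) => i; case: (idP i).
Qed.

(** Primes containing [vanishing C] contain both [h] and [vanishing S], so a chain of them extends
    below by the prime [vanishing S], which omits [h]. For [d] the greatest length of a chain for
    [S], no chain of length [d] for [C] can exist. *)
Lemma dim_lt_hypersurface S C h :
    prime_idealr_closed (vanishing S) -> h \notin vanishing S ->
    (forall x, C x -> S x) -> h \in vanishing C ->
  dim_lt C S.
Proof.
move=> prS hS sCS hC; have [x0 Sx0 _] := vanishingPn _ _ hS.
have idS := idealr_vanishing Sx0.
have dim0 : dim_ge S 0.
  exists (fun _ => vanishing S); split=> [i|i j]; last by rewrite !ord1.
  by split=> // f /vanishingP.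
have exd : exists d, `[< dim_ge S d >] by exists 0; apply/asboolP.
have ubd d : `[< dim_ge S d >] -> (d <= #|I|)%N by move/asboolP/dim_ge_leq.
case: (ex_maxnP exd ubd) => d /asboolP Sd maxd; exists d => // -[P [idP chP]].
suff /asboolP/maxd : dim_ge S d.+1 by rewrite ltnn.
have sSP i : {subset vanishing S <= P i}.
  move=> f /vanishingP f0; case: (idP i) => _ _; apply => x Cx.
  exact/f0/sCS.
exists (fun i => if unlift ord0 i is Some j then P j else vanishing S).
split=> [i|i j].
  case: unliftP => [j _|_]; last by split=> // f /vanishingP.
  case: (idP j) => idj prj _; split=> // f f0; apply: sSP; exact/vanishingP.
case: (unliftP ord0 i) => [i' ->|->]; case: (unliftP ord0 j) => [j' ->|->] //.
  exact: chP.
move=> _; split; first exact: sSP.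
by exists h => //; case: (idP j') => _ _; apply; apply/vanishingP.
Qed.

(** If [vanishing C] were included in [vanishing S], every chain of primes for [S] would be one for
    [C]. *)
Lemma dim_lt_vanishing S C :
  dim_lt C S -> exists2 h, h \in vanishing C & h \notin vanishing S.
Proof.
case=> d [P [idP chP]] nC; apply: contrapT => no_h; apply: nC.
exists P; split=> // i; case: (idP i) => idi pri sub; split=> // f f0.
apply/sub/vanishingP/negPn/negP => fS; apply: no_h; exists f => //.
exact/vanishingP.
Qed.

End Dimension.

(** Polynomials not vanishing on the image pull back to nonzero functions of the parameters, and
    these are nonzero at a common point. *)
Lemma prime_vanishing_image (R : realType) (I J : finType)
    (phi : J -> {mpoly R[#|I|]}) (S : {ffun J -> R} -> Prop) :
  (forall y, S y <-> exists x, y = pmap phi x) -> prime_idealr_closed (vanishing S).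
Proof.
move=> SE f g; apply: contraTT; rewrite negb_or.
case/andP=> /vanishingPn[_ /SE[x ->] fx] /vanishingPn[_ /SE[y ->] gy].
rewrite -peval_pcomp in fx; rewrite -peval_pcomp in gy.
have [z [fz gz]] := common_nonzero fx gy.
apply/vanishingPn; exists (pmap phi z); first by apply/SE; exists z.
by rewrite pevalM mulf_neq0 // -peval_pcomp.
Qed.

(** * Semialgebraic images *)

(* Only the [eqType] structure of terms: [ord] also redefines [True] and [False]. *)
Import (canonicals) ord.

Section Semialgebraic.
Variables (R : realType).

Fixpoint mpoly_of_term n (t : GRing.term R) : {mpoly R[n]} :=
  match t with
  | GRing.Var i => if insub i is Some k then 'X_k else 0
  | GRing.Const c => c%:MP
  | GRing.NatConst k => k%:R
  | GRing.Add t1 t2 => mpoly_of_term n t1 + mpoly_of_term n t2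
  | GRing.Opp t1 => - mpoly_of_term n t1
  | GRing.NatMul t1 k => mpoly_of_term n t1 *+ k
  | GRing.Mul t1 t2 => mpoly_of_term n t1 * mpoly_of_term n t2
  | GRing.Inv _ => 0 (* junk: excluded by [GRing.rterm] *)
  | GRing.Exp t1 k => mpoly_of_term n t1 ^+ k
  end.

Definition env (I : finType) (x : {ffun I -> R}) : seq R :=
  [seq x (enum_val k) | k <- enum 'I_#|I|].

Lemma size_env (I : finType) (x : {ffun I -> R}) : size (env x) = #|I|.
Proof. by rewrite size_map size_enum_ord. Qed.

Lemma nth_env (I : finType) (x : {ffun I -> R}) (k : 'I_#|I|) :
  (env x)`_k = x (enum_val k).
Proof. by rewrite (nth_map k) ?size_enum_ord // nth_ord_enum. Qed.

Lemma eval_mpoly_of_term (I : finType) (x : {ffun I -> R}) t :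
  GRing.rterm t -> GRing.eval (env x) t = peval (mpoly_of_term #|I| t) x.
Proof.
rewrite /peval; elim: t => //=.
(* A variable out of range reads the default [0] of [nth], as in [mpoly_of_term]. *)
- move=> i _; case: insubP => [k _ <-|]; first by rewrite nth_env mevalXU.
  by rewrite -leqNgt => le_i; rewrite meval0 nth_default // size_env.
- by move=> c _; rewrite mevalC.
- by move=> k _; rewrite rmorph_nat.
- by move=> t1 IH1 t2 IH2 /andP[/IH1-> /IH2->]; rewrite mevalD.
- by move=> t1 IH1 /IH1->; rewrite mevalN.
- by move=> t1 IH1 k /IH1->; rewrite mevalMn.
- by move=> t1 IH1 t2 IH2 /andP[/IH1-> /IH2->]; rewrite mevalM.
- by move=> t1 IH1 k /IH1->; rewrite rmorphXn.
Qed.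

Definition basic_holds e (w : seq (GRing.term R) * seq (GRing.term R)) :=
  (forall t, t \in w.1 -> GRing.eval e t = 0) /\
  (forall t, t \in w.2 -> 0 < GRing.eval e t).

Lemma holds_foldr_And (T : eqType) e (F : T -> ord.formula R) (s : seq T) :
  ord.holds e (foldr (fun t => ord.And (F t)) (ord.Bool true) s) <->
  forall t, t \in s -> ord.holds e (F t).
Proof.
elim: s => [|t s IHs] /=; first by split.
rewrite IHs; split=> [[Ft Fs] u|Fs].
  by rewrite inE => /predU1P[->|/Fs].
by split=> [|u us]; apply: Fs; rewrite inE ?eqxx ?us ?orbT.
Qed.

Lemma holds_dnf e ws :
  ord.holds e (ord.odnf_to_oform (map (@ord.w_to_oclause R) ws)) <->
  exists2 w, w \in ws & basic_holds e w.
Proof.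
elim: ws => [|w ws IHws] /=; first by split=> // -[].
rewrite IHws !holds_foldr_And /=; split=> [[[w1 [_ [w2 _]]]|[u uws hu]]|[u]].
- by exists w; rewrite ?mem_head.
- by exists u; rewrite // inE uws orbT.
rewrite inE => /predU1P[->[h1 h2]|uws hu]; last by right; exists u.
by left.
Qed.

(** Quantifier elimination over the real closed field [R], then disjunctive normal form. *)
Lemma holds_basic_union (f : ord.formula R) :
  exists2 ws : seq (seq (GRing.term R) * seq (GRing.term R)),
    forall w, w \in ws -> forall t, t \in w.1 ++ w.2 -> GRing.rterm t &
    forall e, ord.holds e f <-> exists2 w, w \in ws & basic_holds e w.
Proof.
pose q := ord.quantifier_elim (@qe_rcf.wproj R) (ord.to_rform f).
have /andP[qf_q rq] : ord.qf_form q && ord.rformula q.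
  by apply: ord.quantifier_elim_wf (ord.to_rform_rformula f) => i bc; apply: qe_rcf.wf_QE_wproj.
pose L := ord.qf_to_odnf q false.
have rL : all (@ord.dnf_rterm R) L by apply: ord.qf_to_dnf_rterm.
have fL e : ord.holds e f <-> ord.holds e (ord.odnf_to_oform L).
  rewrite (rwP (qe_rcf.rcf_satP e f)) /qe_rcf.rcf_sat /ord.proj_sat -/q.
  rewrite (rwP (ord.qf_evalP e (ord.dnf_to_form_qf L))) ord.qf_to_dnfP //.
  by rewrite qf_q rq.
exists (flatten (map (@ord.oclause_to_w R) L)).
  move=> w /flatten_mapP[bc bcL wbc] t.
  have /allP/(_ w wbc) := ord.dnf_rterm_subproof (allP rL bc bcL).
  rewrite /= /ord.dnf_rterm /= andbT -all_cat => /allP; exact.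
move=> e; rewrite fL; elim: L {fL rL} => [|bc L IHL] /=; first by split=> // -[].
rewrite -/(ord.odnf_to_oform L) IHL.
(* Literals with [!=] or [<=] are split into cases, leaving only equations and strict
   inequalities. *)
have := ord.oclause_neq_leq_elimP bc e; rewrite ord.oclause_to_wP holds_dnf /= => bcE.
split=> [[h|[w wL hw]]|[w]].
- by case: bcE => /(_ (or_introl h))[w wbc hw] _; exists w; rewrite // mem_cat wbc.
- by exists w; rewrite // mem_cat wL orbT.
rewrite mem_cat => /orP[wbc hw|wL hw]; last by right; exists w.
by case: bcE => _ /(_ (ex_intro2 _ _ w wbc hw)) [h|//]; left.
Qed.

Lemma semialgebraic_holds (I : finType) (S : {ffun I -> R} -> Prop) f :
  (forall x, S x <-> ord.holds (env x) f) -> semialgebraic S.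
Proof.
move=> SE; have [ws rws fE] := holds_basic_union f.
exists [seq (map (mpoly_of_term #|I|) w.1, map (mpoly_of_term #|I|) w.2) | w <- ws].
move=> x; rewrite SE fE; split=> [[w wws [h1 h2]]|[_ /mapP[w wws ->] /= [h1 h2]]].
  exists (map (mpoly_of_term #|I|) w.1, map (mpoly_of_term #|I|) w.2).
    exact: map_f.
  have rw t : t \in w.1 ++ w.2 -> GRing.rterm t by apply: rws wws _.
  split=> _ /mapP[t tw ->]; rewrite -eval_mpoly_of_term;
    by [apply: h1 | apply: h2 | rewrite rw // mem_cat tw ?orbT].
exists w => //; split=> t tw.
  by rewrite eval_mpoly_of_term ?h1 ?map_f // (rws w wws) // mem_cat tw.
by rewrite eval_mpoly_of_term ?h2 ?map_f // (rws w wws) // mem_cat tw orbT.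
Qed.

Lemma holds_foldr_Exists vs e (f : ord.formula R) :
  ord.holds e (foldr ord.Exists f vs) <->
  exists2 e', forall i, i \notin vs -> e'`_i = e`_i & ord.holds e' f.
Proof.
elim: vs e => [|v vs IHvs] e /=.
  split=> [h|[e' ee']]; first by exists e.
  by apply: ord.eq_holds => i; apply: ee'.
split=> [[x /IHvs[e' ee' h]]|[e' ee' h]].
  exists e' => // i; rewrite inE negb_or => /andP[iv ivs].
  by rewrite ee' // nth_set_nth /= (negPf iv).
exists e'`_v; apply/IHvs; exists e' => // i ivs; rewrite nth_set_nth /=.
by case: eqVneq => [->|iv] //; apply: ee'; rewrite inE negb_or iv.
Qed.

Lemma eval_foldr_Add (T : Type) e (F : T -> GRing.term R) s :
  GRing.eval e (foldr (fun t => GRing.Add (F t)) (GRing.NatConst R 0) s) =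
  \sum_(t <- s) GRing.eval e (F t).
Proof. by elim: s => [|t s IHs] /=; rewrite ?big_nil ?big_cons ?IHs. Qed.

Lemma eval_foldr_Mul (T : Type) e (F : T -> GRing.term R) s :
  GRing.eval e (foldr (fun t => GRing.Mul (F t)) (GRing.NatConst R 1) s) =
  \prod_(t <- s) GRing.eval e (F t).
Proof. by elim: s => [|t s IHs] /=; rewrite ?big_nil ?big_cons ?IHs. Qed.

Definition term_of_mpoly n (v : 'I_n -> nat) (f : {mpoly R[n]}) : GRing.term R :=
  foldr (fun m => GRing.Add (GRing.Mul (GRing.Const f@_m)
      (foldr (fun k => GRing.Mul (GRing.Exp (GRing.Var R (v k)) (m k)))
         (GRing.NatConst R 1) (enum 'I_n))))
    (GRing.NatConst R 0) (msupp f).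

Lemma eval_term_of_mpoly n (v : 'I_n -> nat) f e :
  GRing.eval e (term_of_mpoly v f) = f.@[fun k => e`_(v k)].
Proof.
rewrite eval_foldr_Add mevalE; apply: eq_bigr => m _ /=.
by rewrite eval_foldr_Mul big_enum.
Qed.

Lemma semialgebraic_image (I J : finType) (phi : J -> {mpoly R[#|I|]})
    (S : {ffun J -> R} -> Prop) :
  (forall y, S y <-> exists x, y = pmap phi x) -> semialgebraic S.
Proof.
(* The first [#|J|] positions of the environment hold the point of the image; the next [#|I|] hold
   the existentially quantified parameters. *)
move=> SE; pose v (k : 'I_#|I|) := (#|J| + k)%N.
pose eqn (j : 'I_#|J|) := ord.Equal (GRing.Var R j)
  (term_of_mpoly v (phi (enum_val j))).
apply: (semialgebraic_holds
  (f := foldr ord.Exists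
     (foldr (fun j => ord.And (eqn j)) (ord.Bool true) (enum 'I_#|J|))
     (iota #|J| #|I|))) => y.
rewrite SE holds_foldr_Exists; split=> [[x yx]|[e' ee']].
  exists (env y ++ env x) => [i|].
    rewrite mem_iota nth_cat size_env; have [//|le_i] := ltnP i #|J|.
    rewrite -leqNgt => ge_i; rewrite !nth_default ?size_env //.
    by rewrite leq_subRL.
  apply/holds_foldr_And => j _ /=.
  rewrite nth_cat size_env ltn_ord nth_env eval_term_of_mpoly yx ffunE.
  apply: meval_eq => k; rewrite nth_cat size_env ltnNge leq_addr /=.
  by rewrite addKn nth_env.
move/holds_foldr_And => eqns; exists [ffun i => e'`_(v (enum_rank i))].
apply/ffunP => j; rewrite ffunE; move/(_ (enum_rank j)): eqns => /=.
rewrite mem_enum => /(_ isT); rewrite eval_term_of_mpoly ee'; last first.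
  by rewrite mem_iota negb_and -ltnNge ltn_ord.
rewrite nth_env !enum_rankK => ->.
by apply: meval_eq => k; rewrite ffunE enum_valK.
Qed.

Lemma semialgebraic_hypersurface (I : finType) (S : {ffun I -> R} -> Prop) h :
  semialgebraic S -> semialgebraic (fun x => S x /\ peval h x = 0).
Proof.
case=> F SE; exists [seq (h :: c.1, c.2) | c <- F] => x; rewrite SE; split.
  case=> -[c cF [c1 c2]] hx; exists (h :: c.1, c.2); first exact: map_f.
  by split=> // f; rewrite inE => /predU1P[->|/c1].
case=> _ /mapP[c cF ->] /= [c1 c2]; split; last by apply: c1; rewrite mem_head.
by exists c => //; split=> // f fc; apply: c1; rewrite inE fc orbT.
Qed.

End Semialgebraic.

(** * Sums of products of squares *)

Section SquareParametrization.
Variables (K : fieldType) (m n p : nat).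

Notation factor_index := ('I_m + 'I_n + 'I_p)%type.
Notation tensor_index := ('I_m * 'I_n * 'I_p)%type.

Definition sq_outer (y : {ffun factor_index -> K}) : tensor K m n p :=
  outer (\row_a y (inl (inl a)) ^+ 2) (\row_b y (inl (inr b)) ^+ 2)
        (\row_c y (inr c) ^+ 2).

Definition sq_sum k (z : {ffun 'I_k * factor_index -> K}) : tensor K m n p :=
  \sum_(i < k) sq_outer [ffun j => z (i, j)].

Definition sq_sum_mpoly k (t : tensor_index) :
    {mpoly K[#|{: 'I_k * factor_index}|]} :=
  \sum_(i < k) pvar K (i, inl (inl t.1.1)) ^+ 2 * pvar K (i, inl (inr t.1.2)) ^+ 2 *
     pvar K (i, inr t.2) ^+ 2.

Lemma pmap_sq_sum k z : pmap (@sq_sum_mpoly k) z = sq_sum z.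
Proof.
apply/ffunP => t; rewrite ffunE sum_ffunE /peval raddf_sum /=.
by apply: eq_bigr => i _; rewrite !ffunE !mxE !ffunE !mevalM -!/(peval _ _) !peval_pvar.
Qed.

Lemma sq_outer0 : sq_outer 0 = 0.
Proof. by apply/ffunP => t; rewrite !ffunE !mxE !ffunE expr0n !mul0r. Qed.

(** Shorter lists are padded with the zero tensor, which is [sq_outer 0]. *)
Lemma sq_sum_seq k (s : seq (tensor K m n p)) :
    (size s <= k)%N -> (forall T, T \in s -> exists y, T = sq_outer y) ->
  exists z : {ffun 'I_k * factor_index -> K}, \sum_(T <- s) T = sq_sum z.
Proof.
move=> le_s sP.
have /fin_all_exists[y yP] (i : 'I_k) : exists y, nth 0 s i = sq_outer y.
  have [/(mem_nth 0)/sP//|le_i] := ltnP i (size s).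
  by exists 0; rewrite nth_default // sq_outer0.
exists [ffun ij => y ij.1 ij.2].
rewrite /sq_sum (big_nth 0) big_mkord (big_ord_widen k (fun i => s`_i)) //.
rewrite big_mkcond /=; apply: eq_bigr => i _.
have -> : [ffun j => [ffun ij => y ij.1 ij.2] (i, j)] = y i.
  by apply/ffunP => j; rewrite !ffunE.
by rewrite -yP; case: ltnP => // le_i; rewrite nth_default.
Qed.

Lemma seq_of_sq_sum k (z : {ffun 'I_k * factor_index -> K}) :
  exists s, [/\ size s = k, forall T, T \in s -> exists y, T = sq_outer y &
                sq_sum z = \sum_(T <- s) T].
Proof.
exists [seq sq_outer [ffun j => z (i, j)] | i <- enum 'I_k].
rewrite size_map size_enum_ord big_map big_enum; split=> // _ /mapP[i _ ->].
by exists [ffun j => z (i, j)].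
Qed.

Lemma sq_sum_recr k (z : {ffun 'I_k.+1 * factor_index -> K}) :
  exists (x : {ffun 'I_k * factor_index -> K}) y, sq_sum z = sq_sum x + sq_outer y.
Proof.
exists [ffun ij => z (widen_ord (leqnSn k) ij.1, ij.2)], [ffun j => z (ord_max, j)].
rewrite /sq_sum big_ord_recr; congr (_ + _); apply: eq_bigr => i _.
by congr sq_outer; apply/ffunP => j; rewrite !ffunE.
Qed.

Lemma sq_sum_rcons k (x : {ffun 'I_k * factor_index -> K}) y :
  exists z : {ffun 'I_k.+1 * factor_index -> K}, sq_sum x + sq_outer y = sq_sum z.
Proof.
have [s [sz_s sP ->]] := seq_of_sq_sum x.
have -> : \sum_(T <- s) T + sq_outer y = \sum_(T <- rcons s (sq_outer y)) T.
  by rewrite -cats1 big_cat big_seq1.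
apply: sq_sum_seq => [|T]; first by rewrite size_rcons sz_s.
by rewrite mem_rcons inE => /predU1P[->|/sP//]; exists y.
Qed.

Definition is_product (T : tensor K m n p) := exists u v w, T = outer u v w.


Lemma sum_nonzero (s : seq (tensor K m n p)) :
  \sum_(T <- [seq T <- s | T != 0]) T = \sum_(T <- s) T.
Proof.
rewrite big_filter big_mkcond; apply: eq_bigr => T _.
by case: eqVneq => [->|].
Qed.

Lemma sum_of_rank_one_filter (s : seq (tensor K m n p)) :
    (forall T, T \in s -> is_product T) ->
  sum_of (@rank_one K m n p) (\sum_(T <- s) T) [seq T <- s | T != 0].
Proof.
move=> sP; split; last by rewrite sum_nonzero.
by move=> T; rewrite mem_filter => /andP[nzT /sP].
Qed.

(** Products may be zero, rank-one tensors may not: without its zero terms [s] is a rank-one list,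
    and the lower bound forces its length to be [r]. *)
Lemma has_rank_of_lower_bound r (B : tensor K m n p)
    (s : seq (tensor K m n p)) :
    (forall T, T \in s -> is_product T) -> (size s <= r)%N -> B = \sum_(T <- s) T ->
    (forall s', (forall T, T \in s' -> is_product T) -> B = \sum_(T <- s') T ->
       (r <= size s')%N) ->
  has_rank B r.
Proof.
move=> sP sz_s Bs lowB; have sB := sum_of_rank_one_filter sP; rewrite -Bs in sB.
split=> [|s' [s'P Bs']]; last by apply: lowB => // T /s'P[].
exists [seq T <- s | T != 0] => //; apply/eqP; rewrite eqn_leq.
rewrite (leq_trans _ sz_s) ?size_filter ?count_size //= -size_filter.
case: sB => s1P Bs1.
by apply: lowB => // T /s1P[].
Qed.

Lemma tensor_sum_products (A : tensor K m n p) :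
  exists s, [/\ size s = #|{: tensor_index}|, forall T, T \in s -> is_product T &
                A = \sum_(T <- s) T].
Proof.
pose F (t : tensor_index) : tensor K m n p :=
  outer (A t *: delta_mx 0 t.1.1) (delta_mx 0 t.1.2) (delta_mx 0 t.2).
exists [seq F t | t <- enum {: tensor_index}].
rewrite size_map -cardE big_map big_enum /=; split=> //.
  by move=> _ /mapP[t _ ->]; do 3!eexists.
apply/ffunP => t; rewrite sum_ffunE (bigD1 t) //= big1 ?addr0.
  by rewrite ffunE !mxE !eqxx !mulr1.
move=> u; rewrite ffunE !mxE /=; case: u t => [[u1 u2] u3] [[t1 t2] t3] /=.
rewrite !xpair_eqE !(eq_sym u1) !(eq_sym u2) !(eq_sym u3).
by do 3!case: eqVneq => _; rewrite ?mulr0 ?mul0r.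
Qed.

End SquareParametrization.

(** * Complex sums of products and the generic rank *)

Section ComplexTensors.
Variables (R : realType) (m n p : nat).
Notation C := R[i].
Notation factor_index := ('I_m + 'I_n + 'I_p)%type.
Notation tensor_index := ('I_m * 'I_n * 'I_p)%type.

Lemma complex_product_sq_outer (T : tensor C m n p) :
  is_product T -> exists y, T = sq_outer y.
Proof.
case=> u [v [w ->]].
exists [ffun j => match j with
  | inl (inl a) => sqrtc (u 0 a) | inl (inr b) => sqrtc (v 0 b)
  | inr c => sqrtc (w 0 c) end].
by apply/ffunP => t; rewrite !ffunE !mxE !ffunE !sqr_sqrtc.
Qed.

Definition vanish_on_sums k (f : {mpoly C[#|{: tensor_index}|]}) :=
  forall z : {ffun 'I_k * factor_index -> C}, peval f (sq_sum z) = 0.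

(* [f(x + T)] is again a polynomial vanishing on the sums of [k] products
   whenever [T] is a product and [f] vanishes on the sums of [k + 1] of them. *)
Lemma vanish_on_longer_sums k j f :
    (forall g, vanish_on_sums k g -> vanish_on_sums k.+1 g) ->
  vanish_on_sums k f -> vanish_on_sums (j + k) f.
Proof.
move=> stat; elim: j f => [|j IHj] f f0 // z.
have [x [y ->]] := sq_sum_recr z.
pose shift (t : tensor_index) := pvar C t + (sq_outer y t)%:MP.
have shiftE A : pmap shift A = A + sq_outer y.
  by apply/ffunP => t; rewrite !ffunE /peval mevalD mevalC -/(peval _ _) peval_pvar ffunE.
have shift0 : vanish_on_sums k (pcomp f shift).
  move=> x'; rewrite peval_pcomp shiftE.
  by have [z' ->] := sq_sum_rcons x' y; apply: stat.
by have := IHj _ shift0 x; rewrite peval_pcomp shiftE.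
Qed.

Lemma vanish_on_sums_separation k rg :
    complex_generic_rank R m n p rg -> (k < rg)%N ->
  exists2 f, vanish_on_sums k f &
    exists z : {ffun 'I_k.+1 * factor_index -> C}, peval f (sq_sum z) != 0.
Proof.
case=> O [[F OE] [A OA] Og] lt_k; apply: contrapT => no_f.
have stat f : vanish_on_sums k f -> vanish_on_sums k.+1 f.
  by move=> f0 z; apply/eqP/negPn/negP => fz; apply: no_f; exists f => //; exists z.
have [f Ff fA] := (OE A).1 OA.
(* Otherwise [f] would vanish on all longer sums, and [A], expanded in basis tensors, is one of
   them. *)
have /existsNP[z /eqP fz] : ~ vanish_on_sums k f.
  move=> /(vanish_on_longer_sums (j := #|{: tensor_index}|) stat) f0.
  have [s [sz_s sP As]] := tensor_sum_products A.
  have [] := @sq_sum_seq _ _ _ _ (#|{: tensor_index}| + k) s.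
  - by rewrite sz_s leq_addr.
  - by move=> T /sP/complex_product_sq_outer.
  by move=> z zE; move: fA; rewrite As zE f0 eqxx.
(* A sum of [k] products thus lies in the open set where the rank is [rg], which contradicts
   [k < rg]. *)
have /Og[_ minz] : O (sq_sum z) by apply/OE; exists f.
have [s [sz_s sP zE]] := seq_of_sq_sum z.
have /minz : sum_of (@rank_one C m n p) (sq_sum z) [seq T <- s | T != 0].
  rewrite zE; apply: sum_of_rank_one_filter => T /sP[y ->].
  by do 3!eexists.
rewrite leqNgt => /negP[]; rewrite (leq_ltn_trans _ lt_k) // -sz_s size_filter.
exact: count_size.
Qed.

End ComplexTensors.

(** * Real tensors *)

(** The exceptional set is the section of [S] by the hypersurface [h = 0]. *)
Lemma general_point_image (R : realType) (I J : finType)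
    (phi : J -> {mpoly R[#|I|]}) (S Q : {ffun J -> R} -> Prop) h :
    (forall y, S y <-> exists x, y = pmap phi x) -> h \notin vanishing S ->
    (forall y, S y -> peval h y != 0 -> Q y) ->
  general_point S Q.
Proof.
move=> SE hS SQ; exists (fun y => S y /\ peval h y = 0); split.
- exact/semialgebraic_hypersurface/(semialgebraic_image SE).
- by move=> y [].
- move=> y Sy nQ; split=> //; apply/eqP/negPn/negP => hy; exact/nQ/SQ.
apply: dim_lt_hypersurface hS _ _ => [|y []//|].
- exact: prime_vanishing_image SE.
- by apply/vanishingP => y [].
Qed.

Section RealTensors.
Variables (R : realType) (m n p : nat).
Notation C := R[i].
Notation factor_index := ('I_m + 'I_n + 'I_p)%type.
Notation tensor_index := ('I_m * 'I_n * 'I_p)%type.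
Implicit Types (A T : tensor R m n p) (s : seq (tensor R m n p)).

Lemma nonneg_productP T : nonneg_product T <-> exists y, T = sq_outer y.
Proof.
split=> [[u [v [w [u0 v0 w0 ->]]]]|[y ->]]; last first.
  by do 3!eexists; split; last reflexivity; move=> i; rewrite mxE sqr_ge0.
exists [ffun j => match j with
  | inl (inl a) => Num.sqrt (u 0 a) | inl (inr b) => Num.sqrt (v 0 b)
  | inr c => Num.sqrt (w 0 c) end].
by apply/ffunP => t; rewrite !ffunE !mxE !ffunE !sqr_sqrtr.
Qed.

Lemma nonneg_product_is_product T : nonneg_product T -> is_product T.
Proof. by case=> u [v [w [_ _ _ ->]]]; exists u, v, w. Qed.

Lemma nonneg_rank_leP r A :
  nonneg_rank_le r A <-> exists z : {ffun 'I_r * factor_index -> R}, A = sq_sum z.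
Proof.
split=> [[_ [k [[s [sP ->] <-] _]] le_r]|[z ->]].
  by apply: sq_sum_seq le_r _ => T /sP/nonneg_productP.
have [s [sz_s sP ->]] := seq_of_sq_sum z.
have sA : sum_of (@nonneg_product R m n p) (\sum_(T <- s) T) s.
  by split=> // T /sP/nonneg_productP.
split; first by exists s.
pose has_length k := `[< exists2 s', sum_of (@nonneg_product R m n p)
  (\sum_(T <- s) T) s' & size s' = k >].
have lens : has_length r by apply/asboolP; exists s.
case: (ex_minnP (ex_intro _ r lens)) => k /asboolP kA mink.
exists k; last exact: mink.
by split=> // s' s'A; apply: mink; apply/asboolP; exists s'.
Qed.

Lemma complexify_sum s :
  complexify (\sum_(T <- s) T) = \sum_(T <- map (@complexify R m n p) s) T.
Proof.
apply/ffunP => t; rewrite ffunE big_map !sum_ffunE rmorph_sum.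
by apply: eq_bigr => T _; rewrite ffunE.
Qed.

Lemma complexify_product T : is_product T -> is_product (complexify T).
Proof.
case=> u [v [w ->]].
exists (map_mx (real_complex R) u), (map_mx (real_complex R) v),
  (map_mx (real_complex R) w).
by apply/ffunP => t; rewrite !ffunE !mxE !rmorphM.
Qed.

Lemma complexify_sq_sum k (z : {ffun 'I_k * factor_index -> R}) :
  complexify (sq_sum z) = sq_sum (cplx z).
Proof.
apply/ffunP => t; rewrite ffunE !sum_ffunE rmorph_sum; apply: eq_bigr => i _.
by rewrite !ffunE !mxE !ffunE !rmorphM.
Qed.

Definition real_part_mpoly N (phi : C -> R) (f : {mpoly C[N]}) : {mpoly R[N]} :=
  \sum_(e <- msupp f) phi f@_e *: 'X_[e].

(** Monomials are real at real points and [phi], later the real or imaginary part, is linear over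
    [R]. *)
Lemma peval_real_part (I : finType) (phi : {additive C -> R})
    (f : {mpoly C[#|I|]}) (x : {ffun I -> R}) :
    (forall z a, phi (z * real_complex R a) = phi z * a) ->
  peval (real_part_mpoly phi f) x = phi (peval f (cplx x)).
Proof.
move=> phiM; rewrite /peval /real_part_mpoly [in RHS]mevalE !raddf_sum /=; apply: eq_bigr => e _.
rewrite mevalZ mevalX -phiM rmorph_prod; congr (phi (_ * _)).
by apply: eq_bigr => k _; rewrite ffunE rmorphXn.
Qed.

Lemma real_separation k rg :
    complex_generic_rank R m n p rg -> (k < rg)%N ->
  exists2 g : {mpoly R[#|{: tensor_index}|]},
    forall A, (exists z : {ffun 'I_k * factor_index -> C}, complexify A = sq_sum z) ->
      peval g A = 0 &
    exists z : {ffun 'I_k.+1 * factor_index -> R}, peval g (sq_sum z) != 0.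
Proof.
move=> gen lt_k; have [f f0 [z fz]] := vanish_on_sums_separation gen lt_k.
(* Pulled back to the parameters, [f] is not identically zero, hence is nonzero at some real
   parameter. *)
have [x fx] : exists x : {ffun 'I_k.+1 * factor_index -> R},
    peval f (cplx (sq_sum x)) != 0.
  rewrite -pmap_sq_sum -peval_pcomp in fz.
  have [x] := nonzero_at_real fz; rewrite peval_pcomp pmap_sq_sum => fx.
  by exists x; rewrite [cplx _]complexify_sq_sum.
have part0 (phi : {additive C -> R}) :
    (forall z a, phi (z * real_complex R a) = phi z * a) ->
    phi (peval f (cplx (sq_sum x))) != 0 ->
  exists2 g : {mpoly R[#|{: tensor_index}|]},
    forall A, (exists z : {ffun 'I_k * factor_index -> C}, complexify A = sq_sum z) ->
      peval g A = 0 &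
    exists z : {ffun 'I_k.+1 * factor_index -> R}, peval g (sq_sum z) != 0.
  move=> phiM phix; exists (real_part_mpoly phi f).
    move=> A [y Ay]; rewrite peval_real_part // [cplx A]Ay f0; exact: raddf0.
  by exists x; rewrite peval_real_part.
have ReM (a : C) b : complex.Re (a * real_complex R b) = complex.Re a * b.
  by case: a => a1 a2; rewrite /= mulr0 subr0.
have ImM (a : C) b : complex.Im (a * real_complex R b) = complex.Im a * b.
  by case: a => a1 a2; rewrite /= mulr0 add0r.
have [Re0|] := eqVneq (complex.Re (peval f (cplx (sq_sum x)))) 0; last exact: part0.
have [Im0|] := eqVneq (complex.Im (peval f (cplx (sq_sum x)))) 0; last exact: part0.
by move: fx; rewrite [peval _ _]complexE Re0 Im0 mulr0 addr0 eqxx.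
Qed.

(** Real factors of any sign become squares over the complex numbers. The complexified [h], pulled
    back to the parameters, vanishes at the real ones, hence everywhere. *)
Lemma vanish_on_products k (h : {mpoly R[#|{: tensor_index}|]}) s :
    (forall z : {ffun 'I_k * factor_index -> R}, peval h (sq_sum z) = 0) ->
    (size s <= k)%N -> (forall T, T \in s -> is_product T) ->
  peval h (\sum_(T <- s) T) = 0.
Proof.
move=> h0 le_s sP; pose hC := map_mpoly (real_complex R) h.
have hCE A : peval hC (cplx A) = real_complex R (peval h A).
  rewrite /hC [in LHS](mpolyE h) raddf_sum /= /peval [in RHS]mevalE !raddf_sum /=.
  apply: eq_bigr => e _; rewrite map_mpolyZ map_mpolyX mevalZ mevalX rmorphM.
  rewrite rmorph_prod; congr (_ * _); apply: eq_bigr => i _.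
  by rewrite ffunE rmorphXn.
apply: (@complexI R); rewrite rmorph0 -hCE [cplx _]complexify_sum.
have [||z ->] := @sq_sum_seq _ _ _ _ k (map (@complexify R m n p) s).
- by rewrite size_map.
- by move=> _ /mapP[T /sP sT ->]; exact/complex_product_sq_outer/complexify_product.
rewrite -pmap_sq_sum -peval_pcomp; apply/eqP/negPn/negP => /nonzero_at_real[x].
by rewrite peval_pcomp pmap_sq_sum -complexify_sq_sum hCE h0 rmorph0 eqxx.
Qed.

(** A complex decomposition with at most [k] terms, in particular a real one, would give [g] the
    value [0] at [A]; a nonnegative decomposition supplies [k.+1] terms. *)
Lemma has_rank_of_nonvanishing k (g : {mpoly R[#|{: tensor_index}|]}) A :
    (forall B, (exists z : {ffun 'I_k * factor_index -> C}, complexify B = sq_sum z) ->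
      peval g B = 0) ->
    nonneg_rank_le k.+1 A -> peval g A != 0 ->
  has_rank A k.+1 /\ has_rank (complexify A) k.+1.
Proof.
move=> g0 /nonneg_rank_leP[z Az] gA.
have [s [sz_s sP]] := seq_of_sq_sum z; rewrite -Az => As.
have low (l : seq (tensor C m n p)) : (forall B, B \in l -> is_product B) ->
    complexify A = \sum_(B <- l) B -> (k < size l)%N.
  move=> lP Al; rewrite ltnNge; apply: contra_neqN gA => le_k; apply: g0.
  by rewrite Al; apply: sq_sum_seq => // B /lP/complex_product_sq_outer.
have sP' T : T \in s -> is_product T.
  by move=> /sP/nonneg_productP/nonneg_product_is_product.
split.
  apply: (has_rank_of_lower_bound sP' _ As) => [|s' s'P As']; first by rewrite sz_s.
  rewrite -(size_map (@complexify R m n p)); apply: low.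
    by move=> _ /mapP[T /s'P sT ->]; exact: complexify_product.
  by rewrite As' complexify_sum.
apply: (has_rank_of_lower_bound (s := map (@complexify R m n p) s)) => //.
- by move=> _ /mapP[T /sP' sT ->]; exact: complexify_product.
- by rewrite size_map sz_s.
- by rewrite As complexify_sum.
Qed.

Lemma nonneg_rank_decomposition_rank r A s :
    nonneg_rank_decomposition r A s -> has_rank A r -> rank_decomposition r A s.
Proof.
case=> _ sz_s [sP As] rA; split=> //; split=> // T /sP[nzT].
by move=> /nonneg_product_is_product.
Qed.

(** A nonnegative decomposition stripped of its zero terms is a real one, so it keeps at least [r]
    terms: none of [r] terms is zero, and fewer than [r] cannot suffice. *)
Lemma nonneg_rank_decomposition_exists r A :
    nonneg_rank_le r A -> has_rank A r ->
  exists s, nonneg_rank_decomposition r A s.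
Proof.
move=> /nonneg_rank_leP[z Az] [_ minA].
have [s [sz_s sP]] := seq_of_sq_sum z; rewrite -Az => As.
have prodP s' : (forall T, T \in s' -> nonneg_product T) ->
    A = \sum_(T <- s') T -> (r <= size [seq T <- s' | T != 0%R])%N.
  move=> s'P As'; apply: minA; rewrite {1}As'.
  by apply: sum_of_rank_one_filter => T /s'P/nonneg_product_is_product.
have sP' T : T \in s -> nonneg_product T by move=> /sP/nonneg_productP.
have all_s : all (fun T => T != 0) s.
  have := prodP s sP' As.
  by rewrite size_filter -sz_s all_count eqn_leq count_size.
exists s; split=> //; last by split=> // T Ts; split; [exact: (allP all_s) | exact: sP'].
split=> [|s' [s'P As']]; first by exists s.
by apply: leq_trans (prodP s' s'P As') _; rewrite size_filter count_size.
Qed.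

Lemma unique_nonneg_rank_decomposition r A :
    nonneg_rank_le r A -> has_rank A r ->
    unique_upto_order (rank_decomposition r A) ->
  unique_upto_order (nonneg_rank_decomposition r A).
Proof.
move=> rA rkA [s0 _ uniq0]; have [s sA] := nonneg_rank_decomposition_exists rA rkA.
exists s => // s' s'A T.
by rewrite !(uniq0 _ (nonneg_rank_decomposition_rank _ rkA)).
Qed.

End RealTensors.

Theorem theorem5p7 (R : realType) (m n p r rg : nat) :
  (0 < r)%N ->
  complex_generic_rank R m n p rg ->
  (r < rg)%N ->
  general_point (fun A : tensor R m n p => nonneg_rank_le r A)
    (fun A => has_rank A r /\ has_rank (complexify A) r) /\
  (identifiable R m n p r ->
   general_point (fun A : tensor R m n p => nonneg_rank_le r A)
     (fun A => unique_upto_order (nonneg_rank_decomposition r A))).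
Proof.
case: r => [//|k] _ gen lt_rg.
have [g g0 [z gz]] := real_separation gen (ltnW lt_rg).
have DE (A : tensor R m n p) :
    nonneg_rank_le k.+1 A <-> exists z, A = pmap (@sq_sum_mpoly R m n p k.+1) z.
  by rewrite nonneg_rank_leP; split=> -[y ->]; exists y; rewrite pmap_sq_sum.
have rankD A := has_rank_of_nonvanishing (A := A) g0.
have gD : g \notin vanishing (nonneg_rank_le (p:=p) k.+1).
  by apply/vanishingPn; exists (sq_sum z) => //; apply/nonneg_rank_leP; exists z.
split; first exact: general_point_image DE gD rankD.
case=> C [_ _ badC /dim_lt_vanishing[h hC /vanishingPn[B [[s [sP Bs] sz_s] _] hB]]].
(* The tensor [B] is a sum of [k.+1] real products of any sign, so [h] would vanish at [B] if it
   vanished on all tensors of nonnegative rank at most [k.+1]. *)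
have hD : h \notin vanishing (nonneg_rank_le (p:=p) k.+1).
  apply: contraNN hB => /vanishingP h0; rewrite Bs; apply/eqP.
  apply: (@vanish_on_products _ _ _ _ k.+1) => [y||T /sP[]//]; last by rewrite sz_s.
  by apply: h0; apply/nonneg_rank_leP; exists y.
have ghD : g * h \notin vanishing (nonneg_rank_le (p:=p) k.+1).
  by apply/negP => /(prime_vanishing_image DE); rewrite (negPf gD) (negPf hD).
apply: general_point_image DE ghD _ => A DA.
rewrite pevalM mulf_eq0 => /norP[gA hA].
have [rkA _] := rankD A DA gA.
(* Since [g] is nonzero at [A], the real rank is [k.+1]; without uniqueness [A] would lie in [C],
   where [h] is zero. *)
apply: unique_nonneg_rank_decomposition => //; apply: contrapT => nuA.
by move: hA; rewrite (vanishingP _ _ hC) ?eqxx //; exact: badC.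
Qed.
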